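(* Let $n \ge 1$. There exist constants $C_n > 0$ and $\alpha_n \in (0,1)$, depending only on $n$, such that the following holds. Let $U_1, \ldots, U_n$ be a collection of commuting invertible measure preserving transformations on a probability space $(\Omega, \Sigma, \mu)$, and for $0<\alpha<1$ let $\mathsf{C}^*_{\mathsf{S}}(\alpha)$ be the sharp Tauberian constant of the associated ergodic strong maximal operator $\mathsf{M}^*_{\mathsf{S}}$. Then \[ \lim_{\alpha \to 1^-} \mathsf{C}^*_{\mathsf{S}}(\alpha) = 1, \] and in particular \[ \mathsf{C}^*_{\mathsf{S}}(\alpha) - 1 \le C_n \Big(\frac{1}{\alpha} - 1\Big)^{1/n} \qquad \text{for all } \alpha \in (\alpha_n, 1). \]
   Context: A measure preserving transformation $U$ is invertible if it is a bijection of $\Omega$ with $U$ and $U^{-1}$ both measurable and measure preserving; $U^{j}$ for $j<0$ denotes $(U^{-1})^{|j|}$. Let $\mathcal{B}_{\mathsf{S}}$ be the collection of all bounded open rectangles in $\mathbb{R}^n$ which contain the origin and have sides parallel to the coordinate axes. The ergodic strong maximal operator associated with $U_1,\ldots,U_n$ is defined for $f \in L^1(\Omega)$ by \[ \mathsf{M}^*_{\mathsf{S}} f(\omega) = \sup_{R \in \mathcal{B}_{\mathsf{S}}} \frac{1}{\#(R \cap \mathbb{Z}^n)} \sum_{(j_1,\ldots,j_n) \in R \cap \mathbb{Z}^n} |f(U_1^{j_1} \cdots U_n^{j_n}\omega)|, \qquad \omega \in \Omega. \] For $0<\alpha<1$, the sharp Tauberian constant is \[ \mathsf{C}^*_{\mathsf{S}}(\alpha)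 = \sup_{E \in \Sigma,\ \mu(E)>0} \frac{1}{\mu(E)}\, \mu(\{\omega \in \Omega : \mathsf{M}^*_{\mathsf{S}} \chi_E(\omega) > \alpha\}), \] where $\chi_E$ is the indicator function of $E$. *)

(* Defs.v *)
From HB Require Import structures.
From mathcomp Require Export all_boot all_order all_algebra.
From mathcomp Require Export finmap.
From mathcomp Require Export all_classical all_reals all_analysis.
Export Order.TTheory GRing.Theory Num.Theory numFieldNormedType.Exports.

Set Implicit Arguments.
Unset Strict Implicit.
Unset Printing Implicit Defensive.

Local Open Scope classical_set_scope.
Local Open Scope ring_scope.

Record invertible_mpt d (T : measurableType d) (R : realType)
    (mu : probability T R) := InvertibleMPT {
  mpt_fun :> T -> T ;
  mpt_inv : T -> T ;
  mpt_funK : cancel mpt_fun mpt_inv ;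
  mpt_invK : cancel mpt_inv mpt_fun ;
  measurable_mpt_fun : measurable_fun setT mpt_fun ;
  measurable_mpt_inv : measurable_fun setT mpt_inv ;
  mpt_fun_preserving :
    forall A, measurable A -> mu (mpt_fun @^-1` A) = mu A ;
  mpt_inv_preserving :
    forall A, measurable A -> mu (mpt_inv @^-1` A) = mu A }.

Section ergodic_strong_maximal.
Context d (T : measurableType d) (R : realType) (mu : probability T R).

(* [Negz m] stands for the integer [- m.+1]. *)
Definition mpt_pow (U : invertible_mpt mu) (k : int) : T -> T :=
  match k with
  | Posz m => iter m U
  | Negz m => iter m.+1 (mpt_inv U)
  end.

Definition commuting n (U : 'I_n -> invertible_mpt mu) : Prop :=
  forall i k, U i \o U k = U k \o U i.

Definition mpt_multipow n (U : 'I_n -> invertible_mpt mu) (j : 'rV[int]_n) :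
    T -> T :=
  \big[(fun f g => f \o g)/idfun]_(i < n) mpt_pow (U i) (j ord0 i).

Definition open_rectangle n (a b : 'rV[R]_n) : set 'rV[R]_n :=
  [set x | forall i, a ord0 i < x ord0 i < b ord0 i].

Definition strong_basis n : set (set 'rV[R]_n) :=
  [set B | (exists a b, B = open_rectangle a b) /\ B 0].

Definition lattice_points n (B : set 'rV[R]_n) : set 'rV[int]_n :=
  [set j | B (map_mx (fun k : int => k%:~R) j)].

(* Both the cardinality and the sum are the genuine ones because the set of
   lattice points of a bounded rectangle is finite. *)
Definition ergodic_average n (U : 'I_n -> invertible_mpt mu)
    (B : set 'rV[R]_n) (f : T -> R) (w : T) : R :=
  (#|` fset_set (lattice_points B)|%fset)%:R^-1 *
  \sum_(j \in lattice_points B) `|f (mpt_multipow U j w)|.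

Definition ergodic_strong_maximal n (U : 'I_n -> invertible_mpt mu)
    (f : T -> R) (w : T) : \bar R :=
  ereal_sup [set (ergodic_average U B f w)%:E | B in @strong_basis n].

Definition tauberian_constant n (U : 'I_n -> invertible_mpt mu) (alpha : R) :
    \bar R :=
  ereal_sup
    [set (mu [set w | alpha%:E < ergodic_strong_maximal U \1_E w] / mu E)%E
      | E in [set E : set T | measurable E /\ (0 < mu E)%E]].

End ergodic_strong_maximal.

(* Main.v *)
Require Import Defs.
From mathcomp Require Import measurable_realfun.
From mathcomp Require Import zify ring lra.

(* Write [delta^n = 1 - alpha].  If a box [I x R'] containing the origin has a
   proportion less than [delta^n] of points [j] with [U^j w] outside [E], then
   all but a proportion less than [delta^(n-1)] of the fibres [I x {j'}] have a
   proportion less than [delta] of such points, and for these [j'] the point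
   [U'^(j') w] lies in the one-dimensional level set [F1] of [E] along [U_1].
   By induction [w] lies in the [n]-th iterate of [E |-> F1].  In dimension
   one, the maximal ergodic theorem applied to [U] and its inverse gives
   [mu F1 <= (1 + 8 delta) mu E], so the level set has measure at most
   [(1 + 8 delta)^n mu E <= (1 + C_n delta) mu E]. *)

Set Implicit Arguments.
Unset Strict Implicit.
Unset Printing Implicit Defensive.

Local Open Scope classical_set_scope.
Local Open Scope ring_scope.

(** * The maximal ergodic theorem for one map *)

Section maximal_ergodic.
Context d (T : measurableType d) (R : realType) (mu : probability T R).
Variable V : T -> T.

(** This is the maximum of the Birkhoff sums [\sum_(k < m) h (iter k V w)] over [m <= N], the empty
    sum included. The recursion gives [M_(N+1) = h + M_N \o V] wherever [M_(N+1) > 0], as Garsia's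
    argument requires. *)
Fixpoint max_birkhoff (h : T -> R) (N : nat) (w : T) : R :=
  if N is M.+1 then Num.max 0 (h w + max_birkhoff h M (V w)) else 0.

Definition birkhoff_pos (h : T -> R) N := [set w | 0 < max_birkhoff h N w].

Lemma max_birkhoff_ge0 h N w : 0 <= max_birkhoff h N w.
Proof. by case: N => //= N; rewrite le_max lexx. Qed.

Lemma max_birkhoff_leS h N w : max_birkhoff h N w <= max_birkhoff h N.+1 w.
Proof.
elim: N w => [|N IH] w; first exact: max_birkhoff_ge0.
have := IH (V w); rewrite /= => H.
by rewrite ge_max !le_max lexx/= lerD2l H orbT.
Qed.

Lemma max_birkhoff_le h (c : R) N w : (forall v, h v <= c) -> 0 <= c ->
  max_birkhoff h N w <= c *+ N.
Proof.
move=> hc c0; elim: N w => [|N IH] w //=.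
by rewrite ge_max mulrS addr_ge0 ?mulrn_wge0//= lerD.
Qed.

Lemma sum_le_max_birkhoff h N w :
  \sum_(k < N) h (iter k V w) <= max_birkhoff h N w.
Proof.
elim: N w => [|N IH] w; first by rewrite big_ord0.
rewrite big_ord_recl /= le_max; apply/orP; right; rewrite lerD2l.
rewrite (le_trans _ (IH (V w)))//; apply: ler_sum => i _.
by rewrite /bump /= -iterSr.
Qed.

Hypothesis mV : measurable_fun setT V.

Lemma measurable_max_birkhoff h N : measurable_fun setT h ->
  measurable_fun setT (max_birkhoff h N).
Proof.
move=> mh; elim: N => [|N IH] //=; apply: measurable_maxr => //.
by apply: measurable_funD => //; exact: measurableT_comp.
Qed.

Hypothesis Vmu : forall A, measurable A -> mu (V @^-1` A) = mu A.

Lemma measurable_birkhoff_pos h N : measurable_fun setT h ->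
  measurable (birkhoff_pos h N).
Proof.
move=> mh; have -> : birkhoff_pos h N = max_birkhoff h N @^-1` `]0, +oo[.
  by apply/seteqP; split=> w; rewrite /birkhoff_pos/= in_itv/= andbT.
by rewrite -[X in measurable X]setTI; exact: measurable_max_birkhoff.
Qed.

Lemma integral_mpt (f : T -> R) : measurable_fun setT f ->
  (forall w, 0 <= f w) ->
  (\int[mu]_w (f (V w))%:E = \int[mu]_w (f w)%:E)%E.
Proof.
move=> mf f0; have mEf : measurable_fun setT (EFin \o f).
  exact/measurable_EFinP.
have := @ge0_integral_pushforward _ _ _ _ R _ mV mu setT (EFin \o f)
  measurableT mEf (fun y _ => f0 y).
rewrite preimage_setT => <-.
apply: eq_measure_integral => A mA _.
exact: Vmu.
Qed.

(* Garsia: with [M_N] the maximal Birkhoff sum of [c - \1_A], one has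
   [M_(N+1) + \1_(A & M_(N+1) > 0) <= M_N \o V + c \1_(M_(N+1) > 0)];
   integrate and cancel [\int M_N <= \int M_(N+1)]. *)
Lemma max_birkhoff_measure (A : set T) (c : R) N : measurable A -> 0 <= c ->
  (mu (A `&` birkhoff_pos (fun v => (c - \1_A v)%R) N)
   <= c%:E * mu (birkhoff_pos (fun v => (c - \1_A v)%R) N))%E.
Proof.
move=> mA c0; set h := fun v => c - _.
have mh : measurable_fun setT h by apply: measurable_funB.
case: N => [|N].
  have -> : birkhoff_pos h 0 = set0.
    by apply/seteqP; split => w //=; rewrite /birkhoff_pos/= ltxx.
  by rewrite setI0 measure0 mule0.
set P := birkhoff_pos _ _.
set M := max_birkhoff h N; set M' := max_birkhoff h N.+1.
have mM : measurable_fun setT M by exact: measurable_max_birkhoff.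
have mM' : measurable_fun setT M' by exact: measurable_max_birkhoff.
have M0 w : 0 <= M w by exact: max_birkhoff_ge0.
have M'0 w : 0 <= M' w by exact: max_birkhoff_ge0.
have mP : measurable P by exact: measurable_birkhoff_pos.
have mAP : measurable (A `&` P) by exact: measurableI.
have key w : M' w + \1_(A `&` P) w <= M (V w) + c * \1_P w.
  rewrite !indicE in_setI; case: (asboolP (P w)) => Pw.
    rewrite (mem_set Pw) andbT mulr1.
    move: (Pw); rewrite /P /birkhoff_pos /M' /= lt_max ltxx /= => /ltW/max_idPr ->.
    by rewrite /h indicE -/M; lra.
  have -> : (w \in P) = false by apply/negbTE; rewrite notin_setE.
  rewrite andbF mulr0 !addr0 (le_trans _ (M0 _))//.
  by rewrite leNgt; exact/negP.
have : (\int[mu]_w (M' w + \1_(A `&` P) w)%:E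
        <= \int[mu]_w (M (V w) + c * \1_P w)%:E)%E.
  apply: ge0_le_integral => //.
  - by move=> w _; rewrite lee_fin addr_ge0.
  - apply/measurable_EFinP/measurable_funD => //.
  - apply/measurable_EFinP/measurable_funD; first exact: measurableT_comp.
    exact: measurable_funM.
  - by move=> w _; rewrite lee_fin.
under eq_integral do rewrite EFinD.
under [leRHS]eq_integral do rewrite EFinD EFinM.
rewrite ge0_integralD//; first last.
- exact/measurable_EFinP.
- exact/measurable_EFinP.
- by move=> w _; rewrite lee_fin.
rewrite ge0_integralD//; first last.
- by apply: measurable_funeM; exact/measurable_EFinP.
- by move=> w _; rewrite mule_ge0// lee_fin.
- by apply/measurable_EFinP; exact: measurableT_comp.
- by move=> w _; rewrite lee_fin.
rewrite ge0_integralZl//; last exact/measurable_EFinP.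
rewrite !integral_indic// !setIT integral_mpt//.
have MM' : (\int[mu]_w (M w)%:E <= \int[mu]_w (M' w)%:E)%E.
  apply: ge0_le_integral => //; try exact/measurable_EFinP.
  - by move=> w _; rewrite lee_fin.
  - by move=> w _; rewrite lee_fin; exact: max_birkhoff_leS.
(* The integral of [M_N] is cancelled below, so it must be finite: [h <= c] bounds [M_N] by
   [c *+ N]. *)
have Mfin : (\int[mu]_w (M w)%:E)%E \is a fin_num.
  rewrite ge0_fin_numE; last by apply: integral_ge0 => w _; rewrite lee_fin.
  apply: (@le_lt_trans _ _ (\int[mu]_w (cst (c *+ N)%:E w))%E).
    apply: ge0_le_integral => //; try exact/measurable_EFinP.
    by move=> w _; rewrite lee_fin.
    move=> w _; rewrite lee_fin max_birkhoff_le// => v.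
    by rewrite lerBlDr lerDl.
  rewrite integral_cst//.
  by rewrite ltey_eq fin_numM// fin_num_measure.
move=> H; rewrite -(leeD2lE (x := \int[mu]_w (M w)%:E)%E)//.
exact: le_trans (leeD2r _ MM') H.
Qed.

(** Bounding [mu (P N)] by the measure of [A & P N] plus that of the complement of [A] yields the
    factor [c / (1 - c)], at most [2 * c] since [c <= 1/2]. The bound is uniform in [N], so it
    passes to the increasing union [G]. *)
Lemma maximal_ergodic (A : set T) (c : R) : measurable A -> 0 <= c <= 2^-1 ->
  exists G, [/\ measurable G, (mu G <= (2 * c)%:E * mu (~` A))%E &
    forall w q, A w -> \sum_(k < q) \1_A (iter k V w) < c * q%:R -> G w].
Proof.
move=> mA /andP[c0 c2].
pose P := birkhoff_pos (fun v => c - \1_A v).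
have mP N : measurable (P N).
  by apply: measurable_birkhoff_pos; exact: measurable_funB.
have mAP N : measurable (A `&` P N) by exact: measurableI.
have mG : measurable (\bigcup_N (A `&` P N)) by exact: bigcupT_measurable.
exists (\bigcup_N (A `&` P N)); split => //; last first.
  move=> w q Aw H; exists q => //; split => //; rewrite /P/birkhoff_pos/=.
  apply: lt_le_trans (sum_le_max_birkhoff _ _ _).
  rewrite big_split/= sumr_const card_ord sumrN subr_gt0.
  by rewrite -mulr_natr.
have cvgG : (mu \o (fun N => A `&` P N)) x @[x --> \oo]
    --> mu (\bigcup_N (A `&` P N)).
  apply: nondecreasing_cvg_mu => //.
  apply/nondecreasing_seqP => N; apply/subsetPset => w [Aw Pw]; split=> //.
  exact: lt_le_trans Pw (max_birkhoff_leS _ _ _).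
apply: (cvge_to_le cvgG); apply: nearW => N /=.
have := max_birkhoff_measure N mA c0; rewrite -/(P N).
have mAc : measurable (~` A) by exact: measurableC.
have HP : (mu (P N) <= mu (A `&` P N) + mu (~` A))%E.
  apply: le_trans (measureU2 _ _ _) => //.
  apply: le_measure; rewrite ?inE//; first exact: measurableU.
  by move=> w Pw; case: (pselect (A w)) => ?; [left|right].
move: HP.
rewrite -(fineK (fin_num_measure mu _ (mAP N))).
rewrite -(fineK (fin_num_measure mu _ (mP N))).
rewrite -(fineK (fin_num_measure mu _ mAc)).
rewrite -!EFinD -!EFinM !lee_fin.
have : 0 <= fine (mu (A `&` P N)) by rewrite fine_ge0.
have : 0 <= fine (mu (~` A)) by rewrite fine_ge0.
move: (fine _) (fine _) (fine _) => x y z; nra.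
Qed.

End maximal_ergodic.

(** * Integer intervals as lists *)

Definition int_interval (p q : nat) : seq int :=
  [seq Negz k | k <- iota 0 p] ++ [seq Posz k | k <- iota 0 q.+1].

Lemma mem_int_interval p q (k : int) :
  (k \in int_interval p q) = (- p%:Z <= k <= q%:Z).
Proof.
rewrite mem_cat; apply/orP/idP => [[] /mapP[m]|].
- by rewrite mem_iota => ? ->; lia.
- by rewrite mem_iota => ? ->; lia.
case: k => m H; [right|left]; apply/mapP; exists m => //;
  rewrite mem_iota; lia.
Qed.

Lemma int_interval_uniq p q : uniq (int_interval p q).
Proof.
rewrite cat_uniq !map_inj_uniq ?iota_uniq ?andbT; try by move=> ? ? [].
by apply/hasPn => _ /mapP[m _ ->]; apply/mapP => -[].
Qed.

Lemma size_int_interval p q : size (int_interval p q) = (p + q.+1)%N.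
Proof. by rewrite size_cat !size_map !size_iota. Qed.

Lemma big_int_interval (R : realType) p q (f : int -> R) :
  \sum_(k <- int_interval p q) f k =
  \sum_(k < p) f (Negz k) + \sum_(k < q.+1) f (Posz k).
Proof.
rewrite big_cat !big_map; congr (_ + _).
  by rewrite -(big_mkord xpredT (fun k => f (Negz k))) /index_iota subn0.
by rewrite -(big_mkord xpredT (fun k => f (Posz k))).
Qed.

(** * Two-sided averages along one transformation *)

Section one_transformation.
Context d (T : measurableType d) (R : realType) (mu : probability T R).

(* If [w \notin E], then [w] is counted in both halves of the interval, so
   that one of the two one-sided averages of [\1_(~` E)] is below
   [2 delta]; the maximal ergodic theorem applies to [U] and its inverse. *)
Lemma dense_orbit_segments (U : invertible_mpt mu) (E : set T) (delta : R) :
  measurable E -> 0 < delta <= 4^-1 ->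
  exists F, [/\ measurable F, (mu F <= (1 + 8 * delta)%:E * mu E)%E &
    forall w p q,
      \sum_(k <- int_interval p q) \1_(~` E) (mpt_pow U k w)
        < delta * (size (int_interval p q))%:R ->
      F w].
Proof.
move=> mE /andP[d0 d4].
have mEc : measurable (~` E) by exact: measurableC.
(* Each half gets the threshold [c = 2 * delta]; each exceptional set then has measure at most
   [4 * delta * mu E], whence [8 * delta] in all. *)
have d2 : 0 <= 2 * delta <= 2^-1 by lra.
have [G1 [mG1 muG1 HG1]] := maximal_ergodic (measurable_mpt_fun U)
  (@mpt_fun_preserving _ _ _ _ U) mEc d2.
have [G2 [mG2 muG2 HG2]] := maximal_ergodic (measurable_mpt_inv U)
  (@mpt_inv_preserving _ _ _ _ U) mEc d2.
rewrite setCK in muG1 muG2.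
have mG12 : measurable (G1 `|` G2) by exact: measurableU.
exists (E `|` (G1 `|` G2)); split; first exact: measurableU.
  apply: le_trans (measureU2 _ _ _) _ => //.
  apply: (@le_trans _ _ (mu E + (mu G1 + mu G2))%E).
    by rewrite leeD2l// measureU2.
  move: muG1 muG2.
  rewrite -(fineK (fin_num_measure mu _ mE)).
  rewrite -(fineK (fin_num_measure mu _ mG1)).
  rewrite -(fineK (fin_num_measure mu _ mG2)).
  by rewrite -!EFinD -!EFinM !lee_fin; lra.
move=> w p q; rewrite big_int_interval size_int_interval.
case: (pselect (E w)) => [|Ew] H; [by left|right].
pose x := \sum_(k < p) \1_(~` E) (mpt_pow U (Negz k) w) : R.
pose y := \sum_(k < q.+1) \1_(~` E) (mpt_pow U (Posz k) w) : R.
have x0 : 0 <= x by exact: sumr_ge0.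
have w1 : \1_(~` E) w = 1 :> R by rewrite indicE mem_set.
have y1 : 1 <= y by rewrite /y big_ord_recl/= w1 lerDl sumr_ge0.
(* The backward segment has [p.+1] points because it starts at [w] itself, already counted in [y];
   hence the extra 1. *)
have H2 : 1 + x < 2 * delta * p.+1%:R -> G2 w.
  by move=> H2; apply: (HG2 w p.+1) => //; rewrite big_ord_recl/= w1.
have H1 : y < 2 * delta * q.+1%:R -> G1 w by exact: HG1.
rewrite -/x -/y in H.
have [H3|H3] := ltP y (2 * delta * q.+1%:R); first by left; exact: H1.
(* As [1 <= y] and [0 <= x], the bounds on [x + y] and [y] give
   [1 + x <= 2 * x + y < 2 * delta * p]. *)
right; apply: H2; move: H H3; rewrite natrD -!natr1; nra.
Qed.

End one_transformation.

(** * Boxes of integer vectors *)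

Definition row_cons (X : Type) n (k : X) (j : 'rV[X]_n) : 'rV[X]_n.+1 :=
  \row_i (if unlift ord0 i is Some i' then j ord0 i' else k).

Lemma row_cons0 (X : Type) n (k : X) (j : 'rV[X]_n) :
  row_cons k j ord0 ord0 = k.
Proof. by rewrite mxE unlift_none. Qed.

Lemma row_cons_lift (X : Type) n (k : X) (j : 'rV[X]_n) i :
  row_cons k j ord0 (lift ord0 i) = j ord0 i.
Proof. by rewrite mxE liftK. Qed.

Lemma row_consE (X : Type) n (j : 'rV[X]_n.+1) :
  row_cons (j ord0 ord0) (\row_i j ord0 (lift ord0 i)) = j.
Proof.
by apply/rowP => i; rewrite mxE; case: unliftP => [i' ->|->]; rewrite ?mxE.
Qed.

(** The first coordinate runs in the inner loop, so that a sum over the box splits into sums over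
    the fibres in the first direction. In dimension 0 the box is one point, which starts the
    induction. *)
Fixpoint int_box n : ('I_n -> nat) -> ('I_n -> nat) -> seq 'rV[int]_n :=
  if n is m.+1 return ('I_n -> nat) -> ('I_n -> nat) -> seq 'rV[int]_n then
    fun p q => [seq row_cons k j
      | j <- int_box (p \o lift ord0) (q \o lift ord0),
        k <- int_interval (p ord0) (q ord0)]
  else fun _ _ => [:: 0].

Lemma mem_int_box n (p q : 'I_n -> nat) j :
  (j \in int_box p q) =
  [forall i, - (p i)%:Z <= j ord0 i <= (q i)%:Z].
Proof.
elim: n p q j => [|n IH] p q j.
  by rewrite inE [j]thinmx0 eqxx; apply/esym/forallP => -[].
apply/idP/forallP => [/allpairsP[[j' k] /= [Hj Hk ->]] i|H].
  rewrite mxE; case: unliftP => [i' ->|->].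
    by move: Hj; rewrite IH => /forallP; exact.
  by rewrite -mem_int_interval.
apply/allpairsP; exists (\row_i j ord0 (lift ord0 i), j ord0 ord0); split.
- by rewrite IH; apply/forallP => i; rewrite mxE; exact: H.
- by rewrite mem_int_interval; exact: H.
- by rewrite /= row_consE.
Qed.

Lemma int_box_uniq n (p q : 'I_n -> nat) : uniq (int_box p q).
Proof.
elim: n p q => [|n IH] p q //=.
apply: allpairs_uniq => //; first exact: int_interval_uniq.
move=> [j k] [j' k'] _ _ /= /rowP H; congr pair.
  by apply/rowP => i; have := H (lift ord0 i); rewrite !row_cons_lift.
by have := H ord0; rewrite !row_cons0.
Qed.

(** * Induction on the number of transformations *)

Section multipow.
Context d (T : measurableType d) (R : realType) (mu : probability T R).

Lemma mpt_multipow0 (U : 'I_0 -> invertible_mpt mu) j w : mpt_multipow U j w = w.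
Proof. by rewrite /mpt_multipow big_ord0. Qed.

(** [U ord0] is applied last, so with [j] fixed the points of a fibre form a segment of a single
    orbit of [U ord0]. *)
Lemma mpt_multipow_cons n (U : 'I_n.+1 -> invertible_mpt mu) k j w :
  mpt_multipow U (row_cons k j) w =
  mpt_pow (U ord0) k (mpt_multipow (U \o lift ord0) j w).
Proof.
rewrite /mpt_multipow big_ord_recl row_cons0 /=; congr (mpt_pow _ _ _).
congr ((_ : T -> T) w).
by apply: eq_bigr => i _; rewrite row_cons_lift.
Qed.

(** [E] is quantified after [n], since the induction hypothesis is applied to the set [F1] obtained
    from the first transformation. [F] serves all [w], [p] and [q] at once, so that it can control a
    supremum over rectangles. *)
Lemma dense_orbit_boxes (delta : R) : 0 < delta <= 4^-1 ->
  forall n (U : 'I_n -> invertible_mpt mu) E, measurable E ->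
  exists F, [/\ measurable F, (mu F <= ((1 + 8 * delta) ^+ n)%:E * mu E)%E &
    forall w p q,
      \sum_(j <- int_box p q) \1_(~` E) (mpt_multipow U j w)
        < delta ^+ n * (size (int_box p q))%:R ->
      F w].
Proof.
move=> /[dup] hd /andP[d0 d4]; elim=> [|n IH] U E mE.
  exists E; split=> //; first by rewrite mul1e.
  move=> w p q /=; rewrite big_seq1 mpt_multipow0 mul1r indicE.
  case: (boolP (w \in ~` E)) => [_|]; first by rewrite ltxx.
  by move=> /negP H _; apply: contrapT => ?; apply: H; rewrite inE.
have [F1 [mF1 muF1 HF1]] := dense_orbit_segments (U ord0) mE hd.
have [F [mF muF HF]] := IH (U \o lift ord0) F1 mF1.
exists F; split=> //.
  apply: (le_trans muF); rewrite exprSr EFinM -muleA lee_wpmul2l//.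
  by rewrite lee_fin exprn_ge0// addr_ge0// mulr_ge0// ltW.
move=> w p q /=; rewrite big_allpairs_dep size_allpairs => H.
apply: (HF w (p \o lift ord0) (q \o lift ord0)).
set I := int_interval _ _ in H.
have I0 : 0 < (size I)%:R :> R by rewrite ltr0n size_int_interval addnS.
(* Markov's inequality, cleared of denominators: by [HF1] a fibre whose base point lies outside [F1]
   contributes at least [delta * size I] to the sum. *)
rewrite -(ltr_pM2l (mulr_gt0 d0 I0)).
apply: le_lt_trans (lt_le_trans H _); last first.
  by rewrite natrM exprS le_eqVlt; apply/orP; left; apply/eqP; ring.
rewrite mulr_sumr; apply: ler_sum => j _.
under [leRHS]eq_bigr do rewrite mpt_multipow_cons.
rewrite indicE; case: (boolP (_ \in _)) => Hj; last first.
  by rewrite mulr0 sumr_ge0.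
rewrite mulr1 leNgt; apply/negP => /HF1.
by move: Hj; rewrite inE.
Qed.

End multipow.

(** * Lattice points of rectangles *)

Section lattice_points.
Context (R : realType).

Lemma int_itv_oo (a b : R) : a < 0 < b ->
  exists p q : nat, forall k : int,
    (a < k%:~R < b) = (- p%:Z <= k <= q%:Z).
Proof.
move=> /andP[a0 b0].
have fa : Num.floor a < 0 by rewrite floor_lt_int.
have cb : 0 < Num.ceil b by rewrite ceil_gt_int.
(* These come from the least integer above [a] and the greatest below [b]; the first is nonpositive
   and the second nonnegative, so the absolute values lose nothing. *)
exists (absz (Num.floor a + 1)), (absz (Num.ceil b - 1)) => k.
rewrite -floor_lt_int -ceil_gt_int.
move: (Num.floor a) (Num.ceil b) fa cb => x y x0 y0. lia.
Qed.

Lemma strong_basis_lattice n (B : set 'rV[R]_n) : strong_basis B ->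
  exists p q : 'I_n -> nat, lattice_points B = [set` int_box p q].
Proof.
move=> [[a [b ->]] B0].
have H i : exists pq : nat * nat, forall k : int,
    (a ord0 i < k%:~R < b ord0 i) = (- pq.1%:Z <= k <= pq.2%:Z).
  have [|p [q pqE]] := @int_itv_oo (a ord0 i) (b ord0 i).
    by have := B0 i; rewrite mxE.
  by exists (p, q).
have [pq Hpq] := choice H.
exists (fun i => (pq i).1), (fun i => (pq i).2).
apply/seteqP; split => j; rewrite /lattice_points /open_rectangle/= mem_int_box.
  by move=> Hj; apply/forallP => i; rewrite -Hpq; have := Hj i; rewrite mxE.
by move=> /forallP Hj i; rewrite mxE Hpq.
Qed.

Context d (T : measurableType d) (mu : probability T R).

Lemma ergodic_average_box n (U : 'I_n -> invertible_mpt mu) B f w (p q : 'I_n -> nat) :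
  lattice_points B = [set` int_box p q] ->
  ergodic_average U B f w =
  (size (int_box p q))%:R^-1 * \sum_(j <- int_box p q) `|f (mpt_multipow U j w)|.
Proof.
move=> BE; rewrite /ergodic_average BE; congr (_%:R^-1 * _).
  apply: perm_size; apply: uniq_perm; rewrite ?fset_uniq ?int_box_uniq// => j.
  rewrite in_fset_set; last exact: finite_seq.
  by apply/idP/idP; rewrite inE.
by rewrite -fsbig_seq ?int_box_uniq.
Qed.

End lattice_points.

(** * Level sets and bounds on the Tauberian constant *)

Section tauberian.
Context d (T : measurableType d) (R : realType) (mu : probability T R).

Lemma measurable_mpt_pow (U : invertible_mpt mu) k :
  measurable_fun setT (mpt_pow U k).
Proof.
have it (f : T -> T) m : measurable_fun setT f -> measurable_fun setT (iter m f).
  move=> mf; elim: m => [|m IH] //=; first exact: measurable_id.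
  exact: measurableT_comp.
case: k => m /=; first by apply: it; exact: measurable_mpt_fun.
apply: measurableT_comp; first exact: measurable_mpt_inv.
by apply: it; exact: measurable_mpt_inv.
Qed.

Lemma measurable_mpt_multipow n (U : 'I_n -> invertible_mpt mu) j :
  measurable_fun setT (mpt_multipow U j).
Proof.
rewrite /mpt_multipow; elim/big_ind : _.
- exact: measurable_id.
- by move=> f g mf mg; exact: measurableT_comp.
- by move=> i _; exact: measurable_mpt_pow.
Qed.

Lemma measurable_ergodic_average n (U : 'I_n -> invertible_mpt mu) B E :
  strong_basis B -> measurable E ->
  measurable_fun setT (ergodic_average U B \1_E).
Proof.
move=> /strong_basis_lattice[p [q BE]] mE.
rewrite (funext (fun w => ergodic_average_box U \1_E w BE)).
apply: measurable_funM => //; apply: measurable_sum => j.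
apply: measurableT_comp => //; apply: measurableT_comp => //.
exact: measurable_mpt_multipow.
Qed.

(* Only countably many averages occur, as an average only depends on the
   finite set of lattice points of the rectangle. *)
Lemma measurable_ergodic_level n (U : 'I_n -> invertible_mpt mu) E (alpha : R) :
  measurable E ->
  measurable [set w | (alpha%:E < ergodic_strong_maximal U \1_E w)%E].
Proof.
move=> mE.
pose F (pq : {ffun 'I_n -> nat * nat}) := \bigcup_(B in [set B | strong_basis B /\
  lattice_points B = [set` int_box (fst \o pq) (snd \o pq)]])
  [set w | alpha < ergodic_average U B \1_E w].
have -> : [set w | (alpha%:E < ergodic_strong_maximal U \1_E w)%E]
    = \bigcup_pq F pq.
  apply/seteqP; split=> w /=.
    move=> /ereal_sup_gtP[_ [B HB <-]]; rewrite lte_fin => H.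
    have [p [q BE]] := strong_basis_lattice HB.
    pose pq : {ffun 'I_n -> nat * nat} := [ffun i => (p i, q i)].
    have pE : fst \o pq = p by apply/funext => i; rewrite /= ffunE.
    have qE : snd \o pq = q by apply/funext => i; rewrite /= ffunE.
    by exists pq => //; exists B => //; split=> //; rewrite pE qE.
  move=> [pq _ [B [HB _] H]]; apply/ereal_sup_gtP.
  by exists (ergodic_average U B \1_E w)%:E; [exists B|rewrite lte_fin].
apply: countable_bigcupT_measurable => // pq.
(* All rectangles with the same [pq] give the same average, so one representative [B0] is enough. *)
have [[B0 [HB0 B0E]]|none] := pselect (exists B, strong_basis (R := R) B /\
  lattice_points B = [set` int_box (fst \o pq) (snd \o pq)]); last first.
  rewrite (_ : F pq = set0)//; apply/seteqP; split=> w // [B HB _].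
  by apply: none; exists B.
rewrite (_ : F pq = ergodic_average U B0 \1_E @^-1` `]alpha, +oo[).
  rewrite -[X in measurable X]setTI.
  by apply: measurable_ergodic_average => //; exact: HB0.
apply/seteqP; split=> w; rewrite /= in_itv/= andbT.
  by move=> [B [_ BE]] /=; rewrite (ergodic_average_box U _ _ BE)
     (ergodic_average_box U _ _ B0E).
by move=> H; exists B0.
Qed.

(** In the inductive step, with [y = 4 ^+ n >= 1] and [x <= 2], the product of [1 + x] and
    [1 + y * x] is [1 + x + x * y + x ^+ 2 * y <= 1 + 4 * x * y]. It is applied to
    [x = 8 * delta]. *)
Lemma expr1D_le (x : R) n : 0 <= x <= 2 -> (1 + x) ^+ n <= 1 + 4 ^+ n * x.
Proof.
move=> /andP[x0 x2]; elim: n => [|n IH]; first by rewrite !expr0 mul1r lerDl.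
rewrite !exprS.
have : 1 <= 4 ^+ n :> R by rewrite exprn_ege1//; lra.
move: IH; move: (4 ^+ n) ((1 + x) ^+ n) => y z IH y1.
have : (1 + x) * z <= (1 + x) * (1 + y * x) by rewrite ler_wpM2l// addr_ge0.
have : 0 <= x * (y - 1) by rewrite mulr_ge0// subr_ge0.
have : 0 <= (x * y) * (2 - x) by rewrite !mulr_ge0// ?subr_ge0//; lra.
by lra.
Qed.

Lemma ergodic_level_le n (U : 'I_n -> invertible_mpt mu) E (alpha delta : R) :
  0 < delta <= 4^-1 -> 1 - alpha = delta ^+ n -> measurable E ->
  (mu [set w | (alpha%:E < ergodic_strong_maximal U \1_E w)%E]
    <= (1 + 4 ^+ n * (8 * delta))%:E * mu E)%E.
Proof.
move=> hd alphaE mE.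
have [F [mF muF HF]] := dense_orbit_boxes hd U mE.
apply: (@le_trans _ _ (mu F)).
  apply: le_measure; rewrite ?inE//; first exact: measurable_ergodic_level.
  move=> w /= /ereal_sup_gtP[_ [B HB <-]]; rewrite lte_fin.
  have [p [q BE]] := strong_basis_lattice HB.
  rewrite (ergodic_average_box U _ _ BE).
  set N := size _.
  case: (posnP N) => [->|N0].
    (* An empty box would have average 0, as the inverse of 0 is 0, and [alpha < 0] is impossible
       since [delta ^+ n <= 1]. *)
    rewrite invr0 mul0r => alpha0; exfalso; move: alphaE alpha0.
    have : delta ^+ n <= 1 by rewrite exprn_ile1//; lra.
    lra.
  rewrite mulrC ltr_pdivlMr ?ltr0n// => H; apply: (HF w p q).
  rewrite -alphaE -/N.
  have -> : \sum_(j <- int_box p q) \1_(~` E) (mpt_multipow U j w) =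
     N%:R - \sum_(j <- int_box p q) `|\1_E (mpt_multipow U j w)| :> R.
    rewrite /N -sum1_size natr_sum -sumrB; apply: eq_bigr => j _.
    by rewrite !indicE in_setC; case: (_ \in E) => /=; rewrite normr_nat ?subrr ?subr0.
  by lra.
apply: (le_trans muF); rewrite lee_wpmul2r// lee_fin expr1D_le//; lra.
Qed.

Lemma tauberian_constant_le n (U : 'I_n -> invertible_mpt mu) (alpha delta : R) :
  0 < delta <= 4^-1 -> 1 - alpha = delta ^+ n ->
  (tauberian_constant U alpha <= (1 + 4 ^+ n * (8 * delta))%:E)%E.
Proof.
move=> hd alphaE; apply: ge_ereal_sup => _ [E [mE muE0] <-].
have muEfin := fin_num_measure mu _ mE.
move: muE0 (ergodic_level_le U hd alphaE mE).
by rewrite -(fineK muEfin) lte_fin => muE0; rewrite inver gt_eqF// lee_pdivrMr.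
Qed.

(** Take the whole space for [E]: each average over a nonempty box is 1, and the cube of half-width
    1 supplies such a box. *)
Lemma tauberian_constant_ge1 n (U : 'I_n -> invertible_mpt mu) (alpha : R) :
  alpha < 1 -> (1 <= tauberian_constant U alpha)%E.
Proof.
move=> a1; apply: ereal_sup_ubound; exists setT.
  by split=> //; rewrite probability_setT lte_fin.
rewrite (_ : [set w | _] = setT) ?probability_setT ?inve1 ?mule1//.
apply/seteqP; split=> // w _ /=.
pose B : set 'rV[R]_n := open_rectangle (const_mx (- 1)) (const_mx 1).
have HB : strong_basis B.
  by split; [exists (const_mx (- 1)), (const_mx 1)|move=> i; rewrite !mxE; lra].
apply/ereal_sup_gtP; exists (ergodic_average U B \1_setT w)%:E; first by exists B.
have [p [q BE]] := strong_basis_lattice HB.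
rewrite lte_fin (ergodic_average_box U _ _ BE).
have Hs : (0 < size (int_box p q))%N.
  have : 0 \in int_box p q.
    by rewrite mem_int_box; apply/forallP => i; rewrite mxE; lia.
  by case: int_box.
under eq_bigr do rewrite indicE in_setT normr1.
by rewrite big_const_seq count_predT iter_addr_0 mulVf// pnatr_eq0 -lt0n.
Qed.

End tauberian.

(** * Choice of the constants, and the limit *)

Theorem theorem1p8 (R : realType) (n : nat) (hn : (1 <= n)%N) :
  exists C alpha_n : R,
    [/\ 0 < C, 0 < alpha_n < 1 &
      forall (d : measure_display) (T : measurableType d)
        (mu : probability T R) (U : 'I_n -> invertible_mpt mu),
        commuting U ->
        (tauberian_constant U alpha @[alpha --> 1^'-] --> 1%E) /\
        (forall alpha : R, alpha_n < alpha < 1 ->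
          (tauberian_constant U alpha - 1%E <=
            (C * (alpha^-1 - 1) `^ n%:R^-1)%:E)%E)].
Proof.
have n0 : 0 < n%:R^-1 :> R by rewrite invr_gt0 ltr0n.
have c0 : 0 < 4^-1 ^+ n :> R by rewrite exprn_gt0//; lra.
have c1 : 4^-1 ^+ n <= 4^-1 :> R.
  by rewrite -[leRHS]expr1 ler_wiXn2l//; lra.
pose K : R := 4 ^+ n * 8.
have K0 : 0 < K by rewrite mulr_gt0// exprn_gt0.
(* This threshold keeps [delta], the [n]-th root of [1 - alpha], below 1/4. *)
exists K, (1 - 4^-1 ^+ n); split; [exact: K0|by lra|].
move=> d T mu U _.
have main e : 0 < e <= 4^-1 ^+ n ->
    (tauberian_constant U (1 - e) <= (1 + K * e `^ n%:R^-1)%:E)%E.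
  move=> /andP[e0 ec]; rewrite /K -mulrA.
  have rootK (x : R) : 0 <= x -> (x ^+ n) `^ n%:R^-1 = x.
    by move=> x0; rewrite -powR_mulrn// -powRrM divff ?pnatr_eq0 -?lt0n// powRr1.
  apply: tauberian_constant_le.
    rewrite powR_gt0//= -[leRHS]rootK; last by lra.
    by rewrite ge0_ler_powR ?nnegrE// ltW.
  rewrite opprB addrC subrK -powR_mulrn ?powR_ge0// -powRrM mulVf ?pnatr_eq0 -?lt0n//.
  by rewrite powRr1// ltW.
split; last first.
  move=> alpha /andP[a0 a1].
  have alpha0 : 0 < alpha by lra.
  have := main (1 - alpha); rewrite subKr => /(_ _)/le_trans H.
  rewrite leeBlDr// -EFinD addrC; apply: H; first by lra.
  (* [1 - alpha <= alpha^-1 - 1], because the right side is [(1 - alpha) / alpha]. *)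
  rewrite lee_fin lerD2l ler_wpM2l ?(ltW K0)// ge0_ler_powR ?nnegrE ?(ltW n0)//.
  - by lra.
  - by rewrite subr_ge0 invf_ge1// ltW.
  - have : alpha * alpha^-1 = 1 by rewrite divff// gt_eqF.
    have : 1 <= alpha^-1 by rewrite invf_ge1// ltW.
    move: alpha^-1 => y; nra.
(* With [e = 1 - alpha] the constant is squeezed between 1 and the bound of [main]; the limit is
   then carried from [e] at [0^'+] to [alpha] at [1^'-]. *)
have lim0 : tauberian_constant U (1 - e) @[e --> 0^'+] --> 1%E.
  apply: (@squeeze_cvge _ _ _ _ (cst 1%E) _ (fun e => (1 + K * e `^ n%:R^-1)%:E)).
  - near=> e; rewrite /= tauberian_constant_ge1/=; last first.
      by rewrite ltrBlDr ltrDl; near: e; exact: nbhs_right_gt.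
    apply: main; apply/andP; split; near: e; first exact: nbhs_right_gt.
    exact: nbhs_right_le.
  - exact: cvg_cst.
  - apply: cvg_EFin; first by near=> e.
    rewrite -[X in _ --> X]addr0 -[X in _ --> _ + X](mulr0 K).
    by apply: cvgD; [exact: cvg_cst|apply: cvgMr; exact: powR_cvg0].
move=> A /lim0 HA.
have := nbhs_left0P 1 [set alpha | A (tauberian_constant U alpha)].
by move=> [_]; apply.
Unshelve. all: by end_near.
Qed.
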